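(* For an integer $N \geq 1$ and points $x_1, \dots, x_N \in \mathbb{T}$ put $$ A = \frac{2}{N}\int_{0}^{N/2} \left| \frac{1}{N}\, \# \left\{ (m,n): 1 \leq m, n \leq N,\ m \neq n,\ |x_m - x_n| \leq \frac{s}{N} \right\} - 2s \right|^2 ds . $$ There exist absolute constants $C_1, C_2, c > 0$ such that for all integers $N \geq 1$ and all $x_1,\dots,x_N \in \mathbb{T}$, with discrepancy $D_N$: (i) $A \leq C_1 N^2 D_N^2$; (ii) if $D_N \geq C_2 N^{-1/3}$, then $A \geq c\, N^2 D_N^5$.
   Context: $\mathbb{T} = \mathbb{R}/\mathbb{Z}$ is the one-dimensional torus, identified with $[0,1]$ with endpoints glued. For $x,y \in \mathbb{T}$, $|x-y|$ denotes the distance on the torus, i.e. the distance from $x-y$ to the nearest integer. Pairs $(m,n)$ are ordered, and points are counted by index. The discrepancy of $x_1,\dots,x_N$ is $$ D_N = \sup_{I \subset \mathbb{T}} \left| \frac{\#\{1 \leq n \leq N : x_n \in I\}}{N} - |I| \right|, $$ where the supremum ranges over all intervals (arcs) $I \subset \mathbb{T}$ and $|I|$ is the length of $I$. *)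

(* Defs.v *)
From HB Require Import structures.
From mathcomp Require Import all_boot all_order all_algebra.
From mathcomp Require Import all_classical all_reals all_analysis.

Set Implicit Arguments.
Unset Strict Implicit.
Unset Printing Implicit Defensive.

Import Order.TTheory GRing.Theory Num.Theory.
Import numFieldNormedType.Exports.

Local Open Scope classical_set_scope.
Local Open Scope ring_scope.

(* A point of the torus R/Z is given by an arbitrary real representative;
   torus_dist and torus_arc depend only on the classes modulo Z of the points. *)

Definition torus_dist (R : realType) (x y : R) : R :=
  inf [set `|x - y - k%:~R| | k in [set: int]].

(* The preimage in R of the image in R/Z of the interval with endpoints a and b.
   The booleans tell which endpoints belong to it: BSide true a = BLeft a and
   BSide false b = BRight b include the endpoint when they are respectively the
   lower and the upper bound. *)
Definition torus_arc (R : realType) (sa sb : bool) (a b : R) : set R :=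
  [set x | exists k : int,
     x + k%:~R \in Interval (BSide sa a) (BSide sb b)].

(* The arcs are the images of the intervals of R of length b - a <= 1, which is
   then also the length of the arc. *)
Definition discrepancy (R : realType) (N : nat) (x : 'I_N -> R) : R :=
  sup [set r : R | exists sa sb : bool, exists a b : R,
         a <= b <= a + 1 /\
         r = `| #|[pred n : 'I_N | x n \in torus_arc sa sb a b]|%:R / N%:R
                - (b - a) |].

Definition close_pairs (R : realType) (N : nat) (x : 'I_N -> R) (s : R) : nat :=
  #|[pred p : 'I_N * 'I_N |
      (p.1 != p.2) && (torus_dist (x p.1) (x p.2) <= s / N%:R)]|.

(* The integrand is a bounded piecewise polynomial function of s, so that the
   real-valued Lebesgue integral is the genuine one. *)
Definition pair_deviation (R : realType) (N : nat) (x : 'I_N -> R) : R :=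
  2 / N%:R *
  \int[@lebesgue_measure R]_(s in `[0, N%:R / 2])
    (`| N%:R^-1 * (close_pairs x s)%:R - 2 * s | ^+ 2).

(* Main.v *)
Require Import Defs.
From mathcomp Require Import all_boot all_order all_algebra.
From mathcomp Require Import all_classical all_reals all_analysis.
From mathcomp Require Import measurable_realfun zify ring lra.
Import Order.TTheory GRing.Theory Num.Theory.
Import numFieldNormedType.Exports.
Set Implicit Arguments.
Unset Strict Implicit.
Unset Printing Implicit Defensive.
Local Open Scope classical_set_scope.
Local Open Scope ring_scope.

(* (i) Counting around each x_m gives |integrand| <= (2 N D)^2, the omitted
   diagonal pair costing at most 1 <= N D.

   (ii) Let F(z) = #{n : x_n in [0, z)} / N - z on the torus, and write g for the
   L^2 norm on [0, 1/2] of the pair-count deviation (divided by N^2) as a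
   function of t = s / N.  Expanding the square over pairs of points,
   \int (F(z + d) - F(z))^2 dz is the integral over [0, d] of that deviation (up
   to the diagonal), hence at most d^(1/2) (g + O(1/N)).  So the averages of F
   over two adjacent windows of length d differ by at most
   d^(-1/4) (g + O(1/N))^(1/2), and summing over dyadic scales bounds the
   oscillation of the d-averages of F by a multiple of the same quantity.  As F
   decreases at speed at most 1, averages at scale d ~ D detect the discrepancy:
   D <= C D^(-1/4) (g + O(1/N))^(1/2).  The hypothesis on D absorbs the O(1/N).

   The torus is replaced by the grid Z / 2^m with m = 2 N, so that these
   integrals in z become finite sums; the grid errors are O(2^-m). *)


(** * Distance on the torus *)

Section TorusDistance.
Variable R : realType.
Implicit Types x y t : R.

(** The infimum is attained at the integer [k0] nearest to [x - y]: every other integer is at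
    distance at least 1 from [k0], hence at least 1/2 from [x - y]. *)
Lemma torus_dist_le x y t :
  reflect (exists k : int, `|x - y - k%:~R| <= t) (torus_dist x y <= t).
Proof.
have lb : has_lbound [set `|x - y - k%:~R| | k in [set: int]].
  by exists 0 => _ [k _ <-].
apply: (iffP idP) => [dt|[k kt]]; last first.
  by apply: le_trans kt; apply: ge_inf => //; exists k.
pose k0 := Num.floor (x - y + 1 / 2).
exists k0; apply: le_trans dt.
apply: lb_le_inf; first by exists `|x - y - 0%:~R|, 0.
move=> _ [k _ <-].
have [e1 e2] : k0%:~R <= x - y + 1 / 2 /\ x - y + 1 / 2 < k0%:~R + 1.
  have := floor_itv (x - y + 1 / 2); rewrite intrD /k0 => /andP[]; split; assumption.
have [->//|kk0] := eqVneq k k0.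
have d1 : 1 <= `|(k - k0)%:~R : R|.
  by rewrite -intr_norm ler1z; move/eqP: kk0; lia.
move: d1; rewrite intrB => d1.
have : `|x - y - k0%:~R| <= 1 / 2 by rewrite ler_norml; lra.
have := ler_distD (x - y) (k%:~R : R) k0%:~R.
rewrite (distrC k%:~R (x - y)); lra.
Qed.

Lemma torus_dist_ge0 x y : 0 <= torus_dist x y.
Proof.
by apply: lb_le_inf => [|_ [k _ <-]//]; exists `|x - y - 0%:~R|, 0.
Qed.

Lemma torus_dist_refl x : torus_dist x x = 0.
Proof.
apply/eqP; rewrite eq_le torus_dist_ge0 andbT; apply/torus_dist_le.
by exists 0; rewrite subrr subr0 normr0.
Qed.

End TorusDistance.

(** * Discrepancy, counts in arcs, and the pointwise bound behind (i) *)

Section Discrepancy.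
Variables (R : realType) (N : nat) (x : 'I_N -> R).

Definition arc_count (sa sb : bool) (a b : R) : nat :=
  #|[pred n : 'I_N | x n \in torus_arc sa sb a b]|.

Lemma count_ratio_bounds (P : pred 'I_N) : 0 <= (#|P|%:R / N%:R : R) <= 1.
Proof.
rewrite divr_ge0//=; have [N0|N0] := posnP N.
  by rewrite [X in _ / X%:R]N0 invr0 mulr0.
rewrite ler_pdivrMr ?ltr0n// mul1r ler_nat -[leqRHS]card_ord.
exact: max_card.
Qed.

Lemma le_discrepancy sa sb a b : a <= b <= a + 1 ->
  `|(arc_count sa sb a b)%:R / N%:R - (b - a)| <= discrepancy x.
Proof.
move=> ab; apply: ub_le_sup; last by exists sa, sb, a, b.
exists 1 => _ [sa' [sb' [a' [b' [/andP[ab1 ab2] ->]]]]].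
have := count_ratio_bounds [pred n | x n \in torus_arc sa' sb' a' b'].
by rewrite ler_norml; lra.
Qed.

Lemma discrepancy_le D : (forall sa sb a b, a <= b <= a + 1 ->
    `|(arc_count sa sb a b)%:R / N%:R - (b - a)| <= D) ->
  discrepancy x <= D.
Proof.
move=> H; apply: ge_sup.
  exists `|(arc_count true true 0 0)%:R / N%:R - (0 - 0)|, true, true, 0, 0.
  by split=> //; apply/andP; split; lra.
by move=> _ [sa [sb [a [b [ab ->]]]]]; exact: H.
Qed.

Lemma discrepancy_le1 : discrepancy x <= 1.
Proof.
apply: discrepancy_le => sa sb a b /andP[ab1 ab2].
have := count_ratio_bounds [pred n | x n \in torus_arc sa sb a b].
by rewrite /arc_count ler_norml; lra.
Qed.

(** A degenerate arc at one of the points has length 0 and still contains that point. *)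
Lemma discrepancy_ge_invN : (0 < N)%N -> N%:R^-1 <= discrepancy x.
Proof.
move=> N0; have x0 := x (Ordinal N0).
have := @le_discrepancy true false (x (Ordinal N0)) (x (Ordinal N0)).
rewrite lexx ler_wpDr// => /(_ isT); apply: le_trans.
rewrite subrr subr0 ger0_norm// ler_peMl// ler1n.
apply/card_gt0P; exists (Ordinal N0); rewrite !inE.
by exists 0; rewrite in_itv/= addr0 lexx.
Qed.

Lemma mem_closed_arc (a b y : R) :
  reflect (exists k : int, a <= y + k%:~R <= b) (y \in torus_arc true false a b).
Proof.
apply: (iffP idP) => [|[k yk]].
  by rewrite inE => -[k]; rewrite in_itv/=; exists k.
by rewrite inE; exists k; rewrite in_itv.
Qed.

Lemma near_count (m : 'I_N) (t : R) :
  #|[pred n | torus_dist (x m) (x n) <= t]| =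
  arc_count true false (x m - t) (x m + t).
Proof.
apply: eq_card => n; rewrite !inE; apply/torus_dist_le/mem_closed_arc.
  by move=> [k]; rewrite ler_norml => kt; exists k; lra.
by move=> [k kt]; exists k; rewrite ler_norml; lra.
Qed.

(** Keeping the diagonal pairs turns the count into a sum of arc counts around the [x m]; the radius
    is not rescaled by [N]. *)
Definition near_pairs (t : R) : nat :=
  #|[pred p : 'I_N * 'I_N | torus_dist (x p.1) (x p.2) <= t]|.

Lemma near_pairsE (s : R) : 0 <= s ->
  near_pairs (s / N%:R) = (close_pairs x s + N)%N.
Proof.
move=> s0; rewrite /near_pairs /close_pairs.
rewrite -(cardID [pred p : 'I_N * 'I_N | p.1 == p.2]) addnC; congr addn.
have diag_inj : injective (fun n : 'I_N => (n, n)) by move=> n n' [].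
rewrite -[RHS]card_ord -(fintype.card_image diag_inj); apply: eq_card => -[m n].
rewrite !inE/=; apply/andP/fintype.imageP => [[_ /eqP->]|[n' _ [-> ->]]].
  by exists n.
by rewrite torus_dist_refl eqxx divr_ge0.
Qed.

Lemma near_pairs_sum (t : R) :
  near_pairs t =
  (\sum_(m < N) #|[pred n | (torus_dist (x m) (x n) <= t)%R]|)%N.
Proof.
under [RHS]eq_bigr => m _ do rewrite -sum1_card.
by rewrite pair_big_dep /near_pairs -sum1_card.
Qed.

Lemma close_pairsE (s : R) : 0 <= s ->
  (close_pairs x s)%:R + N%:R =
  \sum_(m < N) (arc_count true false (x m - s / N%:R) (x m + s / N%:R))%:R :> R.
Proof.
move=> s0; rewrite -natrD -near_pairsE// near_pairs_sum natr_sum.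
by apply: eq_bigr => m _; rewrite near_count.
Qed.

Lemma close_pairs_deviation (s : R) : (0 < N)%N -> 0 <= s <= N%:R / 2 ->
  `|N%:R^-1 * (close_pairs x s)%:R - 2 * s| <= 2 * N%:R * discrepancy x.
Proof.
move=> N0 /andP[s0 sN]; have N0' : 0 < N%:R :> R by rewrite ltr0n.
set D := discrepancy x; set t := s / N%:R.
have st : s = t * N%:R by rewrite divfK ?gt_eqF.
(* The bound [s <= N / 2] keeps the length [2 * t] of the arcs around the points at most 1, as
   [le_discrepancy] requires. *)
have t2 : t <= 1 / 2 by rewrite ler_pdivrMr//; lra.
have t0 : 0 <= t by rewrite divr_ge0.
pose f m : R := (arc_count true false (x m - t) (x m + t))%:R - 2 * s.
have hf m : `|f m| <= N%:R * D.
  have := @le_discrepancy true false (x m - t) (x m + t).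
  rewrite (_ : x m + t - (x m - t) = 2 * t); last by ring.
  have -> : (x m - t <= x m + t <= x m - t + 1) by apply/andP; split; lra.
  move=> /(_ isT) H.
  have -> : f m = N%:R *
      ((arc_count true false (x m - t) (x m + t))%:R / N%:R - 2 * t).
    by rewrite /f st; field; rewrite gt_eqF.
  by rewrite normrM (gtr0_norm N0') ler_pM2l.
have sumf : \sum_(m < N) f m = (close_pairs x s)%:R + N%:R - 2 * s * N%:R.
  by rewrite close_pairsE// /f sumrB sumr_const card_ord mulr_natr -/t.
have : `|\sum_(m < N) f m| <= N%:R * (N%:R * D).
  apply: le_trans (ler_norm_sum _ _ _) _.
  apply: le_trans (ler_sum _ (fun m _ => hf m)) _.
  by rewrite sumr_const card_ord [leRHS]mulr_natl.
rewrite sumf => H.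
have D1 : 1 <= N%:R * D.
  by rewrite mulrC -ler_pdivrMr// mul1r; exact: discrepancy_ge_invN.
rewrite -(ler_pM2l N0') -{1}(gtr0_norm N0') -normrM mulrBr mulVKf ?gt_eqF//.
have -> : N%:R * (2 * s) = 2 * s * N%:R by ring.
move: H; rewrite !ler_norml.
have : N%:R <= N%:R * (N%:R * D) by rewrite ler_peMr// ltW.
by lra.
Qed.

End Discrepancy.

(** * Integrability of the integrand and comparison of its integral with finite sums *)

Section PairDeviationIntegral.
Variable R : realType.
Notation mu := (@lebesgue_measure R).

Lemma Rintegral_cst_itv (r a b : R) (sa sb : bool) : a <= b ->
  \int[mu]_(s in [set` Interval (BSide sa a) (BSide sb b)]) r = r * (b - a).
Proof.
move=> ab; rewrite Rintegral_cst//; congr (_ * _).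
have := lebesgue_measure_itv (Interval (BSide sa a) (BSide sb b)).
rewrite /= lte_fin => ->; move: ab; rewrite le_eqVlt => /orP[/eqP->|->//].
by rewrite ltxx subrr.
Qed.

Lemma integrable_cst_itv (r a b : R) (sa sb : bool) : mu.-integrable
  [set` Interval (BSide sa a) (BSide sb b)] (EFin \o (fun=> r)).
Proof.
apply: measurable_bounded_integrable => //=.
  by rewrite lebesgue_measure_itv/=; case: ifP => // _; rewrite -EFinB ltry.
by exists `|r|; split; [exact: num_real|move=> M rM y _ /=; exact: ltW].
Qed.

Lemma le_Rintegral_cst (f : R -> R) (a b B : R) : a <= b ->
  mu.-integrable `[a, b] (EFin \o f) ->
  (forall s, a <= s <= b -> f s <= B) ->
  \int[mu]_(s in `[a, b]) f s <= B * (b - a).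
Proof.
move=> ab intf fB.
rewrite -(@Rintegral_cst_itv B a b true false ab).
by apply: le_Rintegral => //; exact: integrable_cst_itv.
Qed.

Lemma Rintegral_step_ge (f : R -> R) (h : R) (b : nat -> R) (n : nat) :
  0 <= h -> mu.-integrable `[0, n%:R * h] (EFin \o f) ->
  (forall i s, (i < n)%N -> i%:R * h <= s <= i.+1%:R * h -> b i <= f s) ->
  h * \sum_(i < n) b i <= \int[mu]_(s in `[0, n%:R * h]) f s.
Proof.
move=> h0; elim: n => [|n IH] intf bf.
  by rewrite big_ord0 mulr0 mul0r set_itv1 Rintegral_set1.
have hn0 : 0 <= n%:R * h by rewrite mulr_ge0.
have hn : n%:R * h <= n.+1%:R * h by rewrite ler_wpM2r// ler_nat.
have int0 : mu.-integrable `[0, n%:R * h] (EFin \o f).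
  apply: integrableS intf => //; apply: subset_itvl.
  by rewrite bnd_simp.
have int1 : mu.-integrable `]n%:R * h, n.+1%:R * h] (EFin \o f).
  apply: integrableS intf => //; apply: subset_itvr.
  by rewrite bnd_simp.
have := @Rintegral_itvB _ f (BLeft 0) (BRight (n.+1%:R * h)) (n%:R * h) intf.
rewrite !bnd_simp => /(_ hn0 hn) /eqP; rewrite subr_eq => /eqP ->.
rewrite big_ord_recr /= mulrDr addrC lerD//; last first.
  by apply: IH => // i s ilt; apply: bf; exact: ltnW.
have -> : h * b n = \int[mu]_(s in `]n%:R * h, n.+1%:R * h]) (b n).
  by rewrite (Rintegral_cst_itv _ false false hn) -natr1; ring.
apply: le_Rintegral => //; first exact: integrable_cst_itv.
by move=> s /=; rewrite in_itv/= => /andP[s1 s2]; apply: bf => //; rewrite s2 ltW.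
Qed.

Variables (N : nat) (x : 'I_N -> R).

Lemma close_pairs_mono (s t : R) : s <= t -> (close_pairs x s <= close_pairs x t)%N.
Proof.
move=> st; apply: subset_leq_card; apply/fintype.subsetP => p.
rewrite !inE => /andP[->/=] ps; apply: le_trans ps _.
by rewrite ler_wpM2r// invr_ge0.
Qed.

(** The pair count is monotone in [s], hence measurable, and on [[a, b]] it is bounded by its value
    at [b]. *)
Lemma pair_deviation_integrable (a b : R) : mu.-integrable `[a, b]
  (EFin \o (fun s => `|N%:R^-1 * (close_pairs x s)%:R - 2 * s| ^+ 2)).
Proof.
have [ab|ab] := leP a b; last first.
  by rewrite set_itv_ge ?bnd_simp -?ltNge//; exact: integrable_set0.
apply: measurable_bounded_integrable => //=.
  by rewrite lebesgue_measure_itv/=; case: ifP => // _; rewrite -EFinB ltry.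
  apply: measurable_funX; apply: measurableT_comp => //.
  apply: measurable_funB; last exact: measurable_funM.
  apply: nondecreasing_measurable => // s t st.
  by rewrite ler_wpM2l ?invr_ge0// ler_nat close_pairs_mono.
exists ((N%:R^-1 * (close_pairs x b)%:R + 2 * (`|a| + `|b|)) ^+ 2).
split; first exact: num_real.
move=> M BM s /=; rewrite in_itv/= => /andP[sa sb].
rewrite ger0_norm ?exprn_ge0//; apply: le_trans (ltW BM).
have H1 : N%:R^-1 * (close_pairs x s)%:R <= N%:R^-1 * (close_pairs x b)%:R :> R.
  by rewrite ler_wpM2l ?invr_ge0// ler_nat close_pairs_mono.
have H0 : 0 <= N%:R^-1 * (close_pairs x s)%:R :> R by rewrite mulr_ge0 ?invr_ge0.
have Hs : `|s| <= `|a| + `|b|.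
  have := ler_norm (- a); have := ler_norm b; rewrite normrN => h1 h2.
  by rewrite ler_norml; have := normr_ge0 a; have := normr_ge0 b; lra.
rewrite lerXn2r// ?nnegrE ?addr_ge0 ?mulr_ge0 ?addr_ge0 ?invr_ge0//.
apply: le_trans (ler_normB _ _) _; rewrite ger0_norm// normrM ger0_norm//.
by lra.
Qed.

Lemma pair_deviation_upper : (0 < N)%N ->
  pair_deviation x <= 4 * N%:R ^+ 2 * discrepancy x ^+ 2.
Proof.
move=> N0; have N0' : 0 < N%:R :> R by rewrite ltr0n.
set B := (2 * N%:R * discrepancy x) ^+ 2.
have := @le_Rintegral_cst _ 0 (N%:R / 2) B _ (pair_deviation_integrable _ _).
rewrite divr_ge0// subr0 => /(_ isT) H.
rewrite /pair_deviation mulrC -ler_pdivlMr ?divr_gt0//.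
have -> : 4 * N%:R ^+ 2 * discrepancy x ^+ 2 / (2 / N%:R) = B * (N%:R / 2).
  by rewrite /B; field; rewrite gt_eqF.
apply: H => s sN; rewrite lerXn2r// ?nnegrE; last exact: close_pairs_deviation.
exact: le_trans (close_pairs_deviation x N0 sN).
Qed.


End PairDeviationIntegral.

(** On cell [i] of a division of [[0, N / 2]] into [n] cells, the count is at least its value at the
    left end and [2 * s] is at most its value at the right end, whence the indices [i] and [i.+1].
    The positive part lets this lower bound be squared. *)
Lemma pair_deviation_lower (R : realType) (N : nat) (x : 'I_N -> R) (n : nat) :
  (0 < N)%N -> (0 < n)%N ->
  \sum_(i < n) Num.max ((close_pairs x (i%:R * (N%:R / n.*2%:R)))%:R / N%:R ^+ 2
                        - i.+1%:R / n%:R) 0 ^+ 2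
  <= n%:R * pair_deviation x / N%:R ^+ 2.
Proof.
move=> N0 n0; have N0' : 0 < N%:R :> R by rewrite ltr0n.
have n0' : 0 < n%:R :> R by rewrite ltr0n.
have n2 : n.*2%:R = 2 * n%:R :> R by rewrite -muln2 natrM mulrC.
set h := N%:R / n.*2%:R.
pose q i : R := (close_pairs x (i%:R * h))%:R / N%:R ^+ 2 - i.+1%:R / n%:R.
have h0 : 0 <= h by rewrite divr_ge0.
have nh : n%:R * h = N%:R / 2 by rewrite /h n2; field; rewrite gt_eqF.
have := @Rintegral_step_ge R (fun s => `|N%:R^-1 * (close_pairs x s)%:R - 2 * s| ^+ 2)
  h (fun i => N%:R ^+ 2 * Num.max (q i) 0 ^+ 2) n h0
  (pair_deviation_integrable _ _ _).
rewrite nh => H.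
rewrite /pair_deviation -(ler_pM2l (exprn_gt0 2 N0')) mulrCA divff ?mulr1; last first.
  by rewrite gt_eqF// exprn_gt0.
rewrite mulr_sumr.
have -> : n%:R * (2 / N%:R * \int[@lebesgue_measure R]_(s in `[0, N%:R / 2])
   `|N%:R^-1 * (close_pairs x s)%:R - 2 * s| ^+ 2) = h^-1 *
   \int[@lebesgue_measure R]_(s in `[0, N%:R / 2])
   `|N%:R^-1 * (close_pairs x s)%:R - 2 * s| ^+ 2.
  by rewrite mulrA; congr (_ * _); rewrite /h n2; field; rewrite !gt_eqF.
rewrite ler_pdivlMl ?divr_gt0 ?ltr0n ?double_gt0//.
apply: H => i s ilt /andP[s1 s2].
rewrite -exprMn lerXn2r// ?nnegrE ?mulr_ge0 ?ler0n ?le_max ?lexx ?orbT//.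
have [q0|q0] := leP (q i) 0; first by rewrite mulr0.
apply: le_trans (ler_norm _).
have H1 : N%:R^-1 * (close_pairs x (i%:R * h))%:R <= N%:R^-1 * (close_pairs x s)%:R :> R.
  by rewrite ler_wpM2l ?invr_ge0// ler_nat close_pairs_mono.
have -> : N%:R * q i = N%:R^-1 * (close_pairs x (i%:R * h))%:R - 2 * (i.+1%:R * h).
  by rewrite /q /h n2; field; rewrite !gt_eqF.
lra.
Qed.

(** * Averages of a periodic sequence over dyadic windows *)

Section DyadicAverages.
Variable R : realType.

(** Cauchy-Schwarz against a constant sequence, from the nonnegativity of the sum of
    [(n * d i - S) ^ 2]. *)
Lemma sqr_sum_le (n : nat) (d : nat -> R) :
  (\sum_(i < n) d i) ^+ 2 <= n%:R * \sum_(i < n) d i ^+ 2.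
Proof.
have [->|n0] := posnP n; first by rewrite big_ord0 mul0r expr0n.
have n0' : 0 < n%:R :> R by rewrite ltr0n.
set S := \sum_(i < n) d i.
have : 0 <= \sum_(i < n) (n%:R * d i - S) ^+ 2 by apply: sumr_ge0 => i _; exact: sqr_ge0.
have -> : \sum_(i < n) (n%:R * d i - S) ^+ 2 =
    n%:R * (n%:R * \sum_(i < n) d i ^+ 2 - S ^+ 2).
  have e i : (n%:R * d i - S) ^+ 2 = n%:R ^+ 2 * d i ^+ 2 - (2 * n%:R * S) * d i + S ^+ 2.
    by ring.
  rewrite (eq_bigr _ (fun (i : 'I_n) _ => e i)) big_split/= sumrB -!mulr_sumr -/S.
  by rewrite sumr_const card_ord -[_ *+ n]mulr_natl; ring.
by rewrite pmulr_rge0// subr_ge0.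
Qed.

Lemma sum_period (M : nat) (G : nat -> R) (a : nat) :
  (forall z, G (z + M)%N = G z) ->
  \sum_(z < M) G (a + z)%N = \sum_(z < M) G z.
Proof.
move=> Gper; elim: a => [//|a IH]; rewrite -IH.
case: M Gper IH => [|M] Gper IH; first by rewrite !big_ord0.
rewrite big_ord_recr [RHS]big_ord_recl /= addrC addn0; congr (_ + _).
  by rewrite addSnnS.
by apply: eq_bigr => i _; rewrite /bump /= add1n addSnnS.
Qed.

(** [F] is sampled on a grid of [2 ^ m] points. With [rho] the fourth root of 2, the powers
    [d^(1/2)] and [d^(-1/4)] of a dyadic length become integer powers of [rho]; [v ^ 2] stands for
    [g + O(1/N)]. *)
Variables (m : nat) (F : nat -> R) (rho v : R).
Hypothesis F_period : forall z, F (z + 2 ^ m)%N = F z.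
Hypothesis F_step : forall z, F z - F z.+1 <= (2 ^ m)%:R^-1.
Hypothesis rho4 : rho ^+ 4 = 2.
Hypothesis rho_ge : 8 / 7 <= rho.
Hypothesis v_ge0 : 0 <= v.
Hypothesis F_shift : forall k, (k < m)%N ->
  \sum_(z < 2 ^ m) (F (z + 2 ^ k)%N - F z) ^+ 2 <= rho ^+ (2 * (m + k)) * v ^+ 2.

Definition dyadic_avg k a : R := (2 ^ k)%:R^-1 * \sum_(z < 2 ^ k) F (a + z)%N.

Let pow2_gt0 k : 0 < (2 ^ k)%:R :> R. Proof. by rewrite ltr0n expn_gt0. Qed.

Lemma pow2_rho k : (2 ^ k)%:R = rho ^+ (4 * k).
Proof. by rewrite natrX exprM rho4. Qed.

(** Cauchy-Schwarz over the [2 ^ k] points of the window gains a factor [2 ^ k = rho ^ (4 k)] on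
    [F_shift], leaving [rho ^ (2 (m - k))] for the square. *)
Lemma dyadic_avg_shift k a : (k < m)%N ->
  `|dyadic_avg k (a + 2 ^ k) - dyadic_avg k a| <= rho ^+ (m - k) * v.
Proof.
move=> km; have rho0 : 0 < rho by apply: lt_le_trans rho_ge; rewrite divr_gt0.
rewrite -ler_sqr ?nnegrE ?mulr_ge0 ?exprn_ge0 ?(ltW rho0)//.
rewrite real_normK ?num_real// /dyadic_avg -mulrBr -sumrB.
pose d z := F (a + 2 ^ k + z)%N - F (a + z)%N.
rewrite exprMn -/d.
have H1 := sqr_sum_le (2 ^ k) d.
have H2 : \sum_(i < 2 ^ k) d i ^+ 2 <= rho ^+ (2 * (m + k)) * v ^+ 2.
  apply: le_trans (F_shift km).
  pose G z := (F (z + 2 ^ k)%N - F z) ^+ 2.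
  (* The squares over the window are part of those over a full period started at [a]. *)
  rewrite -(@sum_period (2 ^ m) G a); last first.
    by move=> z; rewrite /G F_period addnAC F_period.
  have -> : \sum_(i < 2 ^ k) d i ^+ 2 = \sum_(i < 2 ^ k) G (a + i)%N.
    by apply: eq_bigr => i _; rewrite /d /G addnAC.
  rewrite -!(big_mkord xpredT (fun i => G (a + i)%N)).
  rewrite [leRHS](@big_cat_nat _ _ _ (2 ^ k))//=; last by rewrite leq_exp2l// ltnW.
  by rewrite lerDl sumr_ge0// => i _; exact: sqr_ge0.
rewrite exprVn ler_pdivrMl ?exprn_gt0//.
apply: le_trans H1 _.
have -> : (2 ^ k)%:R ^+ 2 * (rho ^+ (m - k) * v) ^+ 2 =
    (2 ^ k)%:R * (rho ^+ (2 * (m + k)) * v ^+ 2).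
  have -> : (2 * (m + k) = 4 * k + (m - k) * 2)%N by lia.
  by rewrite exprD -pow2_rho exprM; ring.
by rewrite ler_pM2l.
Qed.

Lemma dyadic_avgS k a :
  dyadic_avg k.+1 a = (dyadic_avg k a + dyadic_avg k (a + 2 ^ k)) / 2.
Proof.
rewrite /dyadic_avg -mulrDr expnS mul2n -addnn big_split_ord /=.
under [X in _ * (_ + X)]eq_bigr => i _ do rewrite addnA.
have := pow2_gt0 k; rewrite natrD => p0; field; rewrite !gt_eqF//; lra.
Qed.

(* The constant 8 satisfies 8 / rho + 1 <= 8, as rho >= 8 / 7. *)
Lemma dyadic_avg_osc j a b : (j <= m)%N ->
  `|dyadic_avg (m - j) a - dyadic_avg (m - j) b| <= 8 * rho ^+ j * v.
Proof.
have rho0 : 0 < rho by apply: lt_le_trans rho_ge; rewrite divr_gt0.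
elim: j a b => [|j IH] a b jm.
  (* A window of [2 ^ m] points is a full period, so both averages agree and the induction starts
     from oscillation 0. *)
  rewrite /dyadic_avg subn0 !(@sum_period (2 ^ m) F)// subrr normr0.
  by rewrite !mulr_ge0 ?exprn_ge0// ltW.
have {}IH := IH a b (ltnW jm).
have km : (m - j.+1 < m)%N by lia.
(* Halving a window changes its average by half the difference of two adjacent half-windows, once at
   [a] and once at [b]. *)
have Ha := dyadic_avg_shift a km; have Hb := dyadic_avg_shift b km.
have mj : (m - j = (m - j.+1).+1)%N by lia.
move: IH; rewrite mj !dyadic_avgS => IH.
move: Ha Hb; rewrite (_ : (m - (m - j.+1) = j.+1)%N); last by lia.
have Hr : 8 * rho ^+ j * v * (8 / 7) <= 8 * rho ^+ j.+1 * v.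
  rewrite exprS (mulrC rho) mulrA -!mulrA ler_pM2l// ler_wpM2l ?exprn_ge0 ?(ltW rho0)//.
  by rewrite mulrC ler_wpM2r.
set e := rho ^+ j.+1 * v in Hr *.
move: IH Hr; rewrite -!mulrA -/e => IH Hr.
rewrite !ler_norml in IH * => Ha Hb.
lra.
Qed.

Lemma F_drop a z : F a - z%:R / (2 ^ m)%:R <= F (a + z)%N.
Proof.
elim: z => [|z IH]; first by rewrite mul0r subr0 addn0.
have := F_step (a + z); rewrite addnS -natr1 mulrDl mul1r; lra.
Qed.

Lemma dyadic_avg_le k a (B : R) : (forall z, (z < 2 ^ k)%N -> F (a + z)%N <= B) ->
  dyadic_avg k a <= B.
Proof.
move=> FB; rewrite /dyadic_avg ler_pdivrMl// mulr_natl -[X in B *+ X]card_ord -sumr_const.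
by apply: ler_sum => i _; exact: FB.
Qed.

Lemma dyadic_avg_ge k a (B : R) : (forall z, (z < 2 ^ k)%N -> B <= F (a + z)%N) ->
  B <= dyadic_avg k a.
Proof.
move=> FB; rewrite /dyadic_avg ler_pdivlMl// mulr_natl -[X in B *+ X]card_ord -sumr_const.
by apply: ler_sum => i _; exact: FB.
Qed.

(** Since [F] falls slowly, it is nearly bounded below by [F a] on the window starting at [a], and
    nearly bounded above by [F b] on the window ending at [b]; each comparison costs [1 / 2 ^ j]. *)
Lemma F_osc j a b : (j <= m)%N ->
  F a - F b <= 2 / (2 ^ j)%:R + 8 * rho ^+ j * v.
Proof.
move=> jm.
have mj : (2 ^ m = 2 ^ (m - j) * 2 ^ j)%N by rewrite -expnD subnK.
have jE : (2 ^ (m - j))%:R / (2 ^ m)%:R = (2 ^ j)%:R^-1 :> R.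
  by rewrite mj natrM; field; rewrite !gt_eqF.
have lej z : (z <= 2 ^ (m - j))%N -> z%:R / (2 ^ m)%:R <= (2 ^ j)%:R^-1 :> R.
  by move=> zk; rewrite -jE ler_pM2r ?invr_gt0// ler_nat.
have kM : (2 ^ (m - j) <= 2 ^ m)%N by rewrite leq_exp2l// leq_subr.
(* The window that ends just before [b], moved by one period so that the subtraction of naturals
   does not truncate. *)
set b' := (b + 2 ^ m - 2 ^ (m - j))%N.
have H1 : F a - (2 ^ j)%:R^-1 <= dyadic_avg (m - j) a.
  apply: dyadic_avg_ge => z zk; apply: le_trans (F_drop a z).
  by rewrite lerD2l lerN2 lej// ltnW.
have H2 : dyadic_avg (m - j) b' <= F b + (2 ^ j)%:R^-1.
  apply: dyadic_avg_le => z zk.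
  have := F_drop (b' + z) (2 ^ (m - j) - z).
  rewrite (_ : (b' + z + (2 ^ (m - j) - z) = b + 2 ^ m)%N); last first.
    by rewrite /b'; move: zk kM; lia.
  rewrite F_period; have := lej (2 ^ (m - j) - z)%N (leq_subr _ _); lra.
have := dyadic_avg_osc a b' jm; rewrite ler_norml => /andP[_].
lra.
Qed.

End DyadicAverages.

(** * Passage to a grid: cells of the torus and windows of cells *)

Lemma modn_lt_double (M a : nat) : (a < M + M)%N ->
  (a %% M = if a < M then a else a - M)%N.
Proof.
move=> aM; case: ltnP => [/modn_small//|Ma].
by rewrite -{1}(subnK Ma) modnDr modn_small//; lia.
Qed.

(* The triple (z, u, v) is recovered from max u v, because u - v is determined
   modulo M by y1 - y2 and lies strictly between - M / 2 and M / 2. *)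
Lemma residue_triples (M d y1 y2 : nat) (P : pred 'I_d) : (d + d <= M)%N ->
  (forall (z : 'I_M) (u v w : 'I_d), y1 = ((z + u) %% M)%N -> y2 = ((z + v) %% M)%N ->
    (u <= w)%N -> (v <= w)%N -> P w) ->
  (\sum_(z < M) \sum_(u < d) \sum_(v < d)
     (y1 == (z + u) %% M) * (y2 == (z + v) %% M) <= #|P|)%N.
Proof.
move=> dM HP.
pose Q := [pred t : 'I_M * ('I_d * 'I_d) |
  (y1 == (t.1 + t.2.1) %% M)%N && (y2 == (t.1 + t.2.2) %% M)%N].
pose f (t : 'I_M * ('I_d * 'I_d)) := if (t.2.1 <= t.2.2)%N then t.2.2 else t.2.1.
have -> : (\sum_(z < M) \sum_(u < d) \sum_(v < d)
     (y1 == (z + u) %% M) * (y2 == (z + v) %% M) = #|Q|)%N.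
  rewrite -sum1_card [RHS]big_mkcond /=.
  under eq_bigr => z _ do rewrite pair_big /=.
  rewrite pair_big /=; apply: eq_bigr => t _.
  by rewrite inE /=; do 2 case: eqP.
have fQ : {in Q &, injective f}.
  move=> [z [u v]] [z' [u' v']]; rewrite !inE /= /f /=.
  rewrite !modn_lt_double; try by [have := ltn_ord z; have := ltn_ord u; have := ltn_ord v;
    have := ltn_ord z'; have := ltn_ord u'; have := ltn_ord v'; lia].
  move=> /andP[/eqP e1 /eqP e2] /andP[/eqP e3 /eqP e4] /(congr1 val) e5.
  have [? [? ?]] : z = z' :> nat /\ u = u' :> nat /\ v = v' :> nat.
    move: e1 e2 e3 e4 e5 (ltn_ord z) (ltn_ord u) (ltn_ord v) (ltn_ord z')
      (ltn_ord u') (ltn_ord v') => /=.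
    by case: (leqP u v) => ?; case: (leqP u' v') => ? /=; do 4 case: ltnP => ?; lia.
  by congr (_, (_, _)); apply: val_inj.
rewrite -(fintype.card_in_image fQ); apply: subset_leq_card.
apply/fintype.subsetP => w /fintype.imageP[[z [u v]]].
rewrite !inE /= => /andP[/eqP e1 /eqP e2] ->.
by apply: (HP z u v _ e1 e2); rewrite /f /=; case: (leqP u v) => //; exact: ltnW.
Qed.

Section Residues.
Variables (R : realType) (N : nat) (x : 'I_N -> R) (M : nat).
Hypotheses (N_gt0 : (0 < N)%N) (M_gt0 : (0 < M)%N).

(** The index of the cell of length [1 / M] containing [x n]; the absolute value only converts a
    nonnegative remainder to [nat]. *)
Definition residue (n : 'I_N) : nat := `|(Num.floor (M%:R * x n) %% M)%Z|%N.

Definition residue_count (i : nat) : nat := (\sum_(n < N) (residue n == i %% M))%N.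

(** The function F at [z / M], as a sum over cells; it extends periodically because the terms of a
    full period sum to 0. *)
Definition grid_discrepancy (z : nat) : R :=
  \sum_(i < z) ((residue_count i)%:R / N%:R - M%:R^-1).

Let N_gt0' : 0 < N%:R :> R. Proof. by rewrite ltr0n. Qed.
Let M_gt0' : 0 < M%:R :> R. Proof. by rewrite ltr0n. Qed.

Lemma residueE n : (residue n)%:Z = (Num.floor (M%:R * x n) %% M)%Z.
Proof. by rewrite /residue gez0_abs// modz_ge0// gt_eqF. Qed.

Lemma residue_lt n : (residue n < M)%N.
Proof. by rewrite -ltz_nat residueE ltz_pmod. Qed.

Lemma residue_eqP n (i : nat) :
  residue n = (i %% M)%N <-> exists K : int, Num.floor (M%:R * x n) = i%:Z + K * M%:Z.
Proof.
split=> [e|[K e]].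
  exists ((Num.floor (M%:R * x n) %/ M)%Z - (i%:Z %/ M)%Z).
  rewrite {1}(divz_eq (Num.floor (M%:R * x n)) M) -residueE e -modz_nat.
  by rewrite {2}(divz_eq i%:Z M); ring.
by apply/eqP; rewrite -eqz_nat residueE e -modz_nat addrC modzMDl.
Qed.

Lemma residue_bounds n (i : nat) : residue n = (i %% M)%N ->
  exists K : int, i%:R <= M%:R * (x n - K%:~R) < i%:R + 1.
Proof.
move=> /residue_eqP[K e]; exists K.
have := floor_itv (M%:R * x n); rewrite e !intrD intrM.
by move=> /andP[e1 e2]; apply/andP; split; lra.
Qed.

Lemma sum_residue_count : (\sum_(i < M) residue_count i = N)%N.
Proof.
rewrite exchange_big /= -[RHS]card_ord -sum1_card; apply: eq_bigr => n _.
rewrite (bigD1 (Ordinal (residue_lt n)))//= modn_small ?residue_lt// eqxx.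
rewrite big1// => i ni; rewrite modn_small//; apply/eqP; rewrite eqb0.
by apply: contraNneq ni => e; apply/eqP/val_inj.
Qed.

Lemma residue_count_period i : residue_count (i + M) = residue_count i.
Proof. by rewrite /residue_count modnDr. Qed.

Lemma sum_residue_count_shift a : \sum_(i < M) (residue_count (a + i))%:R = N%:R :> R.
Proof.
rewrite (@sum_period _ _ (fun i => (residue_count i)%:R)).
  by rewrite -natr_sum sum_residue_count.
by move=> z; rewrite residue_count_period.
Qed.

Lemma grid_discrepancyD z d : grid_discrepancy (z + d) - grid_discrepancy z =
  (\sum_(i < d) residue_count (z + i))%:R / N%:R - d%:R / M%:R.
Proof.
rewrite /grid_discrepancy big_split_ord /= addrAC subrr add0r sumrB.
by rewrite sumr_const card_ord -mulr_suml -natr_sum -[_ *+ d]mulr_natl.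
Qed.

Lemma grid_discrepancy_period z : grid_discrepancy (z + M) = grid_discrepancy z.
Proof.
apply/eqP; rewrite -subr_eq0 grid_discrepancyD natr_sum sum_residue_count_shift.
by rewrite (divff (lt0r_neq0 N_gt0')) (divff (lt0r_neq0 M_gt0')) subrr.
Qed.

Lemma grid_discrepancy_step z :
  grid_discrepancy z - grid_discrepancy z.+1 <= M%:R^-1.
Proof.
rewrite -[leLHS]opprB -addn1 grid_discrepancyD opprB mul1r gerBl.
by rewrite divr_ge0.
Qed.

(** The cells from that of [a] to that of [b] contain all points of the arc, and their total length
    is at most [b - a + 2 / M]. *)
Lemma closed_arc_excess (a b : R) : a <= b <= a + 1 -> exists z z' : nat,
  (arc_count x true false a b)%:R / N%:R - (b - a) <=
  grid_discrepancy z' - grid_discrepancy z + 2 / M%:R.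
Proof.
move=> /andP[ab _].
pose al := Num.floor (M%:R * a); pose be := Num.floor (M%:R * b).
have albe : al <= be by apply: le_floor; rewrite ler_pM2l.
pose L := `|be - al|%N.+1.
pose z := `|(al %% M)%Z|%N.
have zE : z%:Z = (al %% M)%Z by rewrite /z gez0_abs// modz_ge0//; lia.
exists z, (z + L)%N; rewrite grid_discrepancyD.
have LE : (L%:R : R) = be%:~R - al%:~R + 1.
  by rewrite /L -natr1 natr_absz ger0_norm ?subr_ge0// intrB.
(* For an arc of length close to 1 a cell may be counted twice, which is harmless in an upper
   bound. *)
have H1 : (arc_count x true false a b <= \sum_(i < L) residue_count (z + i))%N.
  rewrite exchange_big /= /arc_count -sum1_card big_mkcond /=.
  apply: leq_sum => n _; case: ifP => // /mem_closed_arc[k /andP[ak kb]].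
  pose f := Num.floor (M%:R * (x n + k%:~R)).
  have fE : f = Num.floor (M%:R * x n) + M%:Z * k.
    by rewrite /f mulrDr -[M%:R in X in _ + X]/(M%:Z%:~R) -intrM floorDrz ?intr_int// intrKfloor.
  have f1 : al <= f by apply: le_floor; rewrite ler_pM2l.
  have f2 : f <= be by apply: le_floor; rewrite ler_pM2l.
  have iL : (`|f - al|%N < L)%N by rewrite /L; lia.
  rewrite (bigD1 (Ordinal iL))//= (_ : residue n = (z + `|f - al|) %% M)%N ?eqxx//.
  apply/residue_eqP; exists ((al %/ M)%Z - k).
  have -> : (z + `|f - al|)%N%:Z = (al %% M)%Z + (f - al) by rewrite PoszD zE; lia.
  have := divz_eq al M; rewrite fE; nia.
have H2 : L%:R <= M%:R * (b - a) + 2.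
  have /andP[_ +] := floor_itv (M%:R * a); have /andP[+ _] := floor_itv (M%:R * b).
  by rewrite -/al -/be intrD LE; lra.
have H3 : L%:R / M%:R <= (b - a) + 2 / M%:R.
  by rewrite ler_pdivrMr// mulrDl divfK ?gt_eqF// mulrC.
have : (arc_count x true false a b)%:R / N%:R <=
    (\sum_(i < L) residue_count (z + i))%:R / N%:R :> R.
  by rewrite ler_pM2r ?invr_gt0// ler_nat.
lra.
Qed.

Lemma closed_arc_complement (sa sb : bool) (a b : R) : a <= b <= a + 1 ->
  (N <= arc_count x sa sb a b + arc_count x true false b (a + 1))%N.
Proof.
move=> /andP[ab ba].
rewrite -[leqLHS]card_ord -cardUI.
apply: leq_trans (leq_addr _ _); apply: subset_leq_card.
apply/fintype.subsetP => n _; rewrite inE; apply/orP.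
pose k := - Num.floor (x n - a).
have /andP[k1 k2] : a <= x n + k%:~R < a + 1.
  have /andP[e1 e2] := floor_itv (x n - a).
  by rewrite /k intrN; move: e2; rewrite intrD => e2; apply/andP; split; lra.
have [bx|xb] := leP b (x n + k%:~R).
  by right; apply: (introT (mem_closed_arc _ _ _)); exists k; rewrite bx ltW.
(* A point at [a] may be excluded from the arc, but its translate [a + 1] belongs to the closed
   complementary arc. *)
move: k1; rewrite le_eqVlt => /orP[/eqP ax|ax].
  right; apply: (introT (mem_closed_arc _ _ _)); exists (k + 1).
  by rewrite intrD addrA -ax lexx ba.
left; rewrite !inE; exists k; rewrite itv_boundlr.
by case: sa; case: sb; rewrite !bnd_simp ?xb ?ax ?ltW.
Qed.

(* A deficit of points in an arc is an excess in the complementary arc, so only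
   excesses in closed arcs have to be compared with the grid. *)
Lemma discrepancy_le_grid (B : R) :
  (forall z z', grid_discrepancy z' - grid_discrepancy z <= B) ->
  discrepancy x <= B + 2 / M%:R.
Proof.
move=> HB; apply: discrepancy_le => sa sb a b ab.
have sub : (arc_count x sa sb a b <= arc_count x true false a b)%N.
  apply: subset_leq_card; apply/fintype.subsetP => n; rewrite !inE => -[k].
  rewrite itv_boundlr => /andP[k1 k2]; exists k; rewrite itv_boundlr.
  apply/andP; split; first by apply: le_trans k1; rewrite bnd_simp; case: (sa).
  by apply: le_trans k2 _; rewrite bnd_simp; case: (sb).
have [z [z' Hz]] := closed_arc_excess ab.
have ab' : b <= a + 1 <= b + 1 by case/andP: ab => ? ?; apply/andP; split; lra.
have [w [w' Hw]] := closed_arc_excess ab'.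
have H1 : (arc_count x sa sb a b)%:R / N%:R <= (arc_count x true false a b)%:R / N%:R :> R.
  by rewrite ler_pM2r ?invr_gt0// ler_nat.
have H2 : 1 <= (arc_count x sa sb a b)%:R / N%:R
    + (arc_count x true false b (a + 1))%:R / N%:R :> R.
  by rewrite -mulrDl ler_pdivlMr// mul1r -natrD ler_nat closed_arc_complement.
have := HB z z'; have := HB w w'.
by rewrite ler_norml; lra.
Qed.

Lemma residue_dist n n' (z u v w : nat) :
  residue n = ((z + u) %% M)%N -> residue n' = ((z + v) %% M)%N ->
  (u <= w)%N -> (v <= w)%N -> torus_dist (x n) (x n') <= w.+1%:R / M%:R.
Proof.
move=> /residue_bounds[K /andP[k1 k2]] /residue_bounds[K' /andP[k1' k2']].
rewrite -(ler_nat R) => uw; rewrite -(ler_nat R) => vw.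
have := ler0n R u; have := ler0n R v => v0 u0.
apply/torus_dist_le; exists (K - K').
rewrite ler_pdivlMr// -(gtr0_norm M_gt0') -normrM intrB -natr1.
move: k1 k2 k1' k2'; rewrite !natrD => k1 k2 k1' k2'.
have -> : (x n - x n' - (K%:~R - K'%:~R)) * M%:R =
  M%:R * (x n - K%:~R) - M%:R * (x n' - K'%:~R) by ring.
rewrite ler_norml; lra.
Qed.

(** The discrete form of the fact that two points at distance [r] share windows of length [d] for a
    measure [d - r] of positions, which is also the measure of the radii in [[r, d]]. The squares
    count pairs of points in a common window; for each pair, [residue_triples] injects these windows
    into the admissible radii. *)
Lemma sum_sqr_residue_count d : (d + d <= M)%N ->
  (\sum_(z < M) (\sum_(i < d) residue_count (z + i)) ^ 2 <=
   \sum_(i < d) near_pairs x (i.+1%:R / M%:R))%N.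
Proof.
move=> dM.
have -> : (\sum_(i < d) near_pairs x (i.+1%:R / M%:R) =
   \sum_(n < N) \sum_(n' < N)
     #|[pred i : 'I_d | (torus_dist (x n) (x n') <= i.+1%:R / M%:R)%R]|)%N.
  rewrite pair_big /=.
  under [RHS]eq_bigr => p _ do rewrite -sum1_card big_mkcond /=.
  rewrite exchange_big /=; apply: eq_bigr => i _.
  by rewrite /near_pairs -sum1_card big_mkcond.
have -> : (\sum_(z < M) (\sum_(i < d) residue_count (z + i)) ^ 2 =
   \sum_(n < N) \sum_(n' < N) \sum_(z < M) \sum_(u < d) \sum_(v < d)
     (residue n == (z + u) %% M) * (residue n' == (z + v) %% M))%N.
  under [RHS]eq_bigr => n _ do rewrite exchange_big /=.
  rewrite [RHS]exchange_big /=; apply: eq_bigr => z _.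
  under eq_bigr => i _ do rewrite /residue_count.
  rewrite exchange_big /= -mulnn big_distrlr /=.
  by apply: eq_bigr => n _; apply: eq_bigr => n' _; rewrite big_distrlr.
apply: leq_sum => n _; apply: leq_sum => n' _.
apply: residue_triples => // z u v w e1 e2 uw vw.
by rewrite inE; exact: residue_dist e1 e2 uw vw.
Qed.

Lemma grid_discrepancy_variance d : (d + d <= M)%N ->
  \sum_(z < M) (grid_discrepancy (z + d) - grid_discrepancy z) ^+ 2 <=
  \sum_(i < d) (near_pairs x (i.+1%:R / M%:R))%:R / N%:R ^+ 2 - d%:R ^+ 2 / M%:R.
Proof.
move=> dM; pose c z : R := (\sum_(i < d) residue_count (z + i))%:R.
(* Every point lies in [d] windows, so the cross term of the expanded square is minus twice the
   constant term [d ^ 2 / M]. *)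
have sumc : \sum_(z < M) c z = d%:R * N%:R.
  rewrite /c; under eq_bigr => z _ do rewrite natr_sum.
  rewrite exchange_big /=.
  under eq_bigr => i _ do (under eq_bigr => z _ do rewrite addnC).
  under eq_bigr => i _ do rewrite sum_residue_count_shift//.
  by rewrite sumr_const card_ord mulr_natl.
have sumc2 : \sum_(z < M) c z ^+ 2 <= \sum_(i < d) (near_pairs x (i.+1%:R / M%:R))%:R.
  have e z : c z ^+ 2 = ((\sum_(i < d) residue_count (z + i)) ^ 2)%N%:R by rewrite natrX.
  by rewrite (eq_bigr _ (fun (z : 'I_M) _ => e z)) -!natr_sum ler_nat sum_sqr_residue_count.
have e z : (grid_discrepancy (z + d) - grid_discrepancy z) ^+ 2 =
    c z ^+ 2 * (N%:R ^- 2) - c z * (2 * d%:R / M%:R / N%:R) + (d%:R / M%:R) ^+ 2.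
  by rewrite grid_discrepancyD// -/(c z); field; rewrite !gt_eqF.
rewrite (eq_bigr _ (fun (z : 'I_M) _ => e z)) big_split/= sumrB.
have -> : \sum_(z < M) (d%:R / M%:R) ^+ 2 = d%:R ^+ 2 / M%:R :> R.
  by rewrite sumr_const card_ord -[LHS]mulr_natl; field; rewrite gt_eqF.
rewrite -!mulr_suml sumc.
have -> : d%:R * N%:R * (2 * d%:R / M%:R / N%:R) = 2 * (d%:R ^+ 2 / M%:R) :> R.
  by field; rewrite !gt_eqF.
have := sumc2; rewrite -(ler_pM2r (_ : 0 < N%:R ^- 2)) ?invr_gt0 ?exprn_gt0//.
lra.
Qed.

End Residues.

(** * Assembly of the lower bound (ii) *)

Lemma fourth_root_two (R : realType) : exists rho : R, rho ^+ 4 = 2 /\ 8 / 7 <= rho.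
Proof.
exists (Num.sqrt (Num.sqrt 2)).
have e : Num.sqrt (Num.sqrt 2) ^+ 4 = 2 :> R.
  by rewrite (exprM _ 2 2) !sqr_sqrtr ?sqrtr_ge0.
split=> //; rewrite leNgt; apply/negP => lt87.
have : Num.sqrt (Num.sqrt 2) ^+ 4 < (8 / 7) ^+ 4 :> R.
  by rewrite ltrXn2r// ?nnegrE ?sqrtr_ge0.
rewrite e; lra.
Qed.

Section LowerBound.
Variables (R : realType) (N : nat) (x : 'I_N -> R).
Hypothesis N_gt0 : (0 < N)%N.
Let N_gt0' : 0 < N%:R :> R. Proof. by rewrite ltr0n. Qed.

Lemma near_pairs_ratio_le1 t : (near_pairs x t)%:R / N%:R ^+ 2 <= 1 :> R.
Proof.
rewrite ler_pdivrMr ?exprn_gt0// mul1r -natrX ler_nat.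
by apply: leq_trans (max_card _) _; rewrite card_prod card_ord mulnn.
Qed.

(** Each count splits into an excess [r i], the diagonal [1 / N] and the mean. Cauchy-Schwarz and
    [pair_deviation_lower] bound the excesses, and the means add up to the last term. *)
Lemma sum_near_pairs_le (n d : nat) : (0 < n)%N -> (d <= n)%N ->
  \sum_(i < d) (near_pairs x (i.+1%:R / n.*2%:R))%:R / N%:R ^+ 2 <=
  Num.sqrt (d%:R * (n%:R * pair_deviation x / N%:R ^+ 2)) +
  d%:R / N%:R + 1 + d%:R * (d%:R + 1) / n.*2%:R.
Proof.
move=> n_gt0 dn; have n_gt0' : 0 < n%:R :> R by rewrite ltr0n.
have n2 : n.*2%:R = 2 * n%:R :> R by rewrite -muln2 natrM mulrC.
pose r i : R := Num.max ((close_pairs x (i%:R * (N%:R / n.*2%:R)))%:R / N%:R ^+ 2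
                        - i.+1%:R / n%:R) 0.
have r0 i : 0 <= r i by rewrite le_max lexx orbT.
have sumr : \sum_(i < d) r i <= Num.sqrt (d%:R * (n%:R * pair_deviation x / N%:R ^+ 2)).
  rewrite -[leLHS]ger0_norm ?sumr_ge0// -sqrtr_sqr ler_wsqrtr//.
  apply: le_trans (sqr_sum_le _ _) _; rewrite ler_wpM2l//.
  apply: le_trans (pair_deviation_lower x N_gt0 n_gt0).
  rewrite -!(big_mkord xpredT (fun i => r i ^+ 2)).
  by rewrite [leRHS](@big_cat_nat _ _ _ d)//= lerDl sumr_ge0// => i _; exact: sqr_ge0.
have Hi i : (near_pairs x (i%:R / n.*2%:R))%:R / N%:R ^+ 2 <=
    r i + N%:R^-1 + i.+1%:R / n%:R.
  have h : i%:R / n.*2%:R = (i%:R * (N%:R / n.*2%:R)) / N%:R :> R.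
    by field; rewrite !gt_eqF// ltr0n double_gt0.
  have -> : near_pairs x (i%:R / n.*2%:R) =
      (close_pairs x (i%:R * (N%:R / n.*2%:R)) + N)%N.
    by rewrite h near_pairsE// mulr_ge0// divr_ge0.
  rewrite natrD mulrDl (_ : N%:R / N%:R ^+ 2 = N%:R^-1); last first.
    by field; rewrite gt_eqF.
  have : (close_pairs x (i%:R * (N%:R / n.*2%:R)))%:R / N%:R ^+ 2
     - i.+1%:R / n%:R <= r i by rewrite le_max lexx.
  lra.
case: d dn sumr => [|d] dn sumr.
  rewrite big_ord0 !mul0r !addr0 addr_ge0// sqrtr_ge0//.
(* The last term is bounded trivially: for d = n its radius shifted by one cell
   would leave the range [0, 1 / 2] of the integral. *)
rewrite big_ord_recr /=.
have last1 := near_pairs_ratio_le1 (d.+1%:R / n.*2%:R).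
(* Radius [i.+1] is matched with term [i.+1] on the right; the extra term 0 there is nonnegative. *)
have : \sum_(i < d) (near_pairs x (i.+1%:R / n.*2%:R))%:R / N%:R ^+ 2 <=
    \sum_(i < d.+1) (r i + N%:R^-1 + i.+1%:R / n%:R).
  rewrite big_ord_recl /= -[leLHS]add0r lerD//; last first.
    by apply: ler_sum => i _; exact: Hi.
  by rewrite !addr_ge0// ?invr_ge0// divr_ge0.
rewrite !big_split/= sumr_const card_ord (_ : N%:R^-1 *+ d.+1 = d.+1%:R / N%:R); last first.
  by rewrite mulr_natl.
have -> : \sum_(i < d.+1) (i.+1%:R / n%:R) = d.+1%:R * (d.+1%:R + 1) / n.*2%:R :> R.
  rewrite -mulr_suml n2; apply: (mulIf (lt0r_neq0 n_gt0')); rewrite divfK ?gt_eqF//.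
  transitivity (d.+1%:R * (d.+1%:R + 1) / 2 : R); last by field; rewrite gt_eqF.
  elim: d {dn sumr last1} => [|k IH]; first by rewrite big_ord1 /=; field.
  by rewrite big_ord_recr /= IH -!natr1; field.
lra.
Qed.

(** The square root [2 ^ N] of the grid size then exceeds [N], which makes the grid errors
    O(1/N). *)
Let m := (2 * N)%N.
(** The substitution [s = N t] shows that this is the L^2 norm on [[0, 1/2]]. *)
Let g : R := Num.sqrt (pair_deviation x / (2 * N%:R ^+ 2)).

Lemma pair_deviation_ge0 : 0 <= pair_deviation x.
Proof.
by rewrite /pair_deviation mulr_ge0// ?divr_ge0// Rintegral_ge0.
Qed.

(** The quadratic means cancel. Three errors remain: [d / N] from the diagonal, 1 from the last
    radius, and [d / 2 ^ m]. Each is at most [P / N], because [d] and [N] are at most [P]; hence the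
    [3 / N]. *)
Lemma grid_discrepancy_shift (rho : R) k : rho ^+ 4 = 2 -> 8 / 7 <= rho -> (k < m)%N ->
  \sum_(z < 2 ^ m) (grid_discrepancy x (2 ^ m) (z + 2 ^ k)
                    - grid_discrepancy x (2 ^ m) z) ^+ 2
  <= rho ^+ (2 * (m + k)) * (g + 3 / N%:R).
Proof.
move=> rho4 rho87 km.
have rho1 : 1 <= rho by lra.
have mS : (m = m.-1.+1)%N by rewrite /m; lia.
have ME : (2 ^ m = (2 ^ m.-1).*2)%N by rewrite {1}mS expnS mul2n.
have dn : (2 ^ k <= 2 ^ m.-1)%N by rewrite leq_exp2l//; lia.
have dM : (2 ^ k + 2 ^ k <= 2 ^ m)%N by rewrite ME -addnn leq_add.
have M_gt0 : (0 < 2 ^ m)%N by rewrite expn_gt0.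
have M_gt0' : 0 < (2 ^ m)%:R :> R by rewrite ltr0n.
apply: le_trans (grid_discrepancy_variance x N_gt0 M_gt0 dM) _.
have n_gt0 : (0 < 2 ^ m.-1)%N by rewrite expn_gt0.
have := sum_near_pairs_le n_gt0 dn; rewrite -ME.
set S := \sum_(i < _) _; set d : R := (2 ^ k)%:R; set P := rho ^+ _ => H.
have P0 : 0 <= P by rewrite exprn_ge0; lra.
have sqrtE : Num.sqrt (d * ((2 ^ m.-1)%:R * pair_deviation x / N%:R ^+ 2)) = P * g.
  have -> : d * ((2 ^ m.-1)%:R * pair_deviation x / N%:R ^+ 2) =
      P ^+ 2 * (pair_deviation x / (2 * N%:R ^+ 2)).
    have -> : P ^+ 2 = d * (2 ^ m.-1)%:R * 2.
      rewrite /P /d -exprM (_ : (2 * (m + k) * 2 = 4 * k + 4 * m.-1 + 4)%N); last by lia.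
      by rewrite (exprD _ (_ + _) 4) rho4 (exprD _ (4 * k)) -!(pow2_rho rho4).
    by field; rewrite gt_eqF.
  by rewrite sqrtrM ?sqr_ge0// sqrtr_sqr ger0_norm.
have dP : d <= P by rewrite /d (pow2_rho rho4) ler_weXn2l//; lia.
have NP : N%:R <= P.
  apply: (@le_trans _ _ (2 ^ N)%:R); first by rewrite ler_nat ltnW// ltn_expl.
  by rewrite (pow2_rho rho4) ler_weXn2l// /m; lia.
have dM1 : d / (2 ^ m)%:R <= 1.
  by rewrite ler_pdivrMr// mul1r ler_nat leq_exp2l// ltnW.
have dN : d / N%:R <= P / N%:R by rewrite ler_pM2r// invr_gt0.
have PN1 : 1 <= P / N%:R by rewrite ler_pdivlMr// mul1r.
have -> : P * (g + 3 / N%:R) = P * g + 3 * (P / N%:R) by ring.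
have e : d * (d + 1) / (2 ^ m)%:R = d ^+ 2 / (2 ^ m)%:R + d / (2 ^ m)%:R by ring.
move: H; rewrite sqrtE e; lra.
Qed.

Lemma discrepancy_le_dyadic (rho : R) j :
  rho ^+ 4 = 2 -> 8 / 7 <= rho -> (j <= m)%N ->
  discrepancy x <= 2 / (2 ^ j)%:R + 8 * rho ^+ j * Num.sqrt (g + 3 / N%:R)
                   + 2 / (2 ^ m)%:R.
Proof.
move=> rho4 rho87 jm.
have M_gt0 : (0 < 2 ^ m)%N by rewrite expn_gt0.
apply: discrepancy_le_grid => // z z'.
apply: (@F_osc R m (grid_discrepancy x (2 ^ m)) rho) => //.
- by move=> w; exact: grid_discrepancy_period.
- by move=> w; exact: grid_discrepancy_step.
- move=> k km; rewrite sqr_sqrtr; last by rewrite addr_ge0 ?sqrtr_ge0 ?divr_ge0.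
  exact: grid_discrepancy_shift.
Qed.

Lemma pair_deviation_lower_bound :
  64 * N%:R `^ (- (1 / 3)) <= discrepancy x ->
  (2 ^+ 21)^-1 * N%:R ^+ 2 * discrepancy x ^+ 5 <= pair_deviation x.
Proof.
move=> HD.
have [rho [rho4 rho87]] := fourth_root_two R.
have D1 := discrepancy_le1 x.
have D0 : 0 < discrepancy x.
  by apply: lt_le_trans HD; rewrite mulr_gt0// powR_gt0.
set D := discrepancy x in HD D1 D0 *.
have D3 : 64 ^+ 3 <= D ^+ 3 * N%:R.
  have H : (64 * N%:R `^ (- (1 / 3))) ^+ 3 <= D ^+ 3.
    by rewrite lerXn2r// ?nnegrE ?mulr_ge0 ?powR_ge0// ltW.
  have pE : (N%:R `^ (- (1 / 3))) ^+ 3 = N%:R^-1 :> R.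
    rewrite -powR_mulrn ?powR_ge0// -powRrM (_ : - (1 / 3) * 3%:R = -1 :> R).
      by rewrite powR_inv1.
    by field.
  by move: H; rewrite exprMn pE ler_pdivrMr.
have N8 : 8 / D <= N%:R.
  rewrite ler_pdivrMr// mulrC; apply: (@le_trans _ _ (D ^+ 3 * N%:R)).
    by apply: le_trans D3; lra.
  by rewrite ler_pM2r// exprSr ler_piMl ?(ltW D0)// exprn_ile1 ?(ltW D0).
have exj : exists j, 8 / D <= (2 ^ j)%:R.
  exists m; apply: le_trans N8 _; rewrite ler_nat.
  by apply: leq_trans (ltnW (ltn_expl N (ltnSn 1))) _; rewrite leq_exp2l// /m; lia.
have Nm : N%:R <= (2 ^ m)%:R :> R.
  rewrite ler_nat; apply: leq_trans (ltnW (ltn_expl N (ltnSn 1))) _.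
  by rewrite leq_exp2l// /m; lia.
(* The least such [j] has [2 ^ j] between [8 / D] and [16 / D]; for [j = 0] the upper bound is just
   [D <= 1]. *)
case: (ex_minnP exj) => j j8 jmin.
have jm : (j <= m)%N by apply: jmin; apply: le_trans N8 Nm.
have j16 : (2 ^ j)%:R <= 16 / D.
  case: j j8 jmin jm => [|j] j8 jmin jm.
    by rewrite ler_pdivlMr// expn0; lra.
  have [H|H] := leP (8 / D) (2 ^ j)%:R; first by have := jmin _ H; rewrite ltnn.
  by rewrite expnS natrM; lra.
(* The two additive errors cost [D / 4] each, so half of [D] is left for the main term. *)
have inv4 (p : R) : 8 / D <= p -> 2 / p <= D / 4.
  move=> Hp; have p0 : 0 < p by apply: lt_le_trans Hp; rewrite divr_gt0.
  by rewrite ler_pdivrMr//; move: Hp; rewrite ler_pdivrMr//; lra.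
have := discrepancy_le_dyadic rho4 rho87 jm; rewrite -/D.
have := inv4 _ j8; have := inv4 _ (le_trans N8 Nm).
set w := g + 3 / N%:R => i1 i2 H.
have g0 : 0 <= g by exact: sqrtr_ge0.
have w0 : 0 <= w by rewrite addr_ge0// divr_ge0.
have D16 : D <= 16 * (rho ^+ j * Num.sqrt w) by lra.
have D4 : D ^+ 4 <= 2 ^+ 16 * ((2 ^ j)%:R * w ^+ 2).
  have -> : 2 ^+ 16 * ((2 ^ j)%:R * w ^+ 2) = (16 * (rho ^+ j * Num.sqrt w)) ^+ 4.
    rewrite !exprMn -exprM (mulnC j) -(pow2_rho rho4) (exprM (Num.sqrt w) 2 2) sqr_sqrtr//.
    have -> : 16 = 2 ^+ 4 :> R by ring.
    by rewrite -exprM.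
  by rewrite lerXn2r ?nnegrE ?(ltW D0)// (le_trans (ltW D0)).
have D5 : D ^+ 5 <= 2 ^+ 20 * w ^+ 2.
  apply: (@le_trans _ _ (2 ^+ 16 * ((2 ^ j)%:R * w ^+ 2) * D)).
    by rewrite exprSr ler_pM2r.
  have -> : 2 ^+ 20 * w ^+ 2 = 2 ^+ 16 * (16 * w ^+ 2).
    by rewrite (exprD 2 16 4) -mulrA; congr (_ * (_ * _)); ring.
  rewrite -mulrA ler_pM2l ?exprn_gt0// mulrAC ler_wpM2r ?sqr_ge0//.
  by rewrite -ler_pdivlMr.
have w2 : w ^+ 2 <= (pair_deviation x + 18) / N%:R ^+ 2.
  have g2 : g ^+ 2 = pair_deviation x / (2 * N%:R ^+ 2).
    by rewrite sqr_sqrtr// divr_ge0 ?pair_deviation_ge0// mulr_ge0// sqr_ge0.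
  have -> : (pair_deviation x + 18) / N%:R ^+ 2 = 2 * g ^+ 2 + 2 * (3 / N%:R) ^+ 2.
    by rewrite g2; field; rewrite gt_eqF.
  by rewrite /w; have := sqr_ge0 (g - 3 / N%:R); lra.
have D5N : D ^+ 5 * N%:R ^+ 2 <= 2 ^+ 20 * (pair_deviation x + 18).
  rewrite -ler_pdivlMr ?exprn_gt0// -mulrA; apply: le_trans D5 _.
  by rewrite ler_pM2l ?exprn_gt0.
(* Squaring [64 ^ 3 <= D ^ 3 * N] and using [D <= 1] makes the error 18 in [D5N] cost at most half
   of the left side, whence the constant [2 ^ 21]. *)
have D6N : 2 ^+ 20 * 36 <= D ^+ 5 * N%:R ^+ 2.
  apply: (@le_trans _ _ ((D ^+ 3 * N%:R) ^+ 2)).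
    apply: (@le_trans _ _ ((64 ^+ 3) ^+ 2)).
      have -> : 64 = 2 ^+ 6 :> R by ring.
      rewrite -!exprM (exprD 2 20 16) ler_pM2l ?exprn_gt0//.
      rewrite (exprD 2 6 10) (_ : 2 ^+ 6 = 64 :> R); last by ring.
      have : 1 <= 2 ^+ 10 :> R by rewrite exprn_ege1//; lra.
      lra.
    by rewrite lerXn2r// ?nnegrE ?exprn_ge0// (le_trans _ D3)// exprn_ge0.
  by rewrite exprMn -exprM ler_pM2r ?exprn_gt0// (exprSr D 5) ler_piMr ?exprn_ge0 ?(ltW D0)//.
rewrite -mulrA ler_pdivrMl ?exprn_gt0// (exprS 2 20) (mulrC (N%:R ^+ 2)) -mulrA.
by move: D5N D6N; rewrite mulrDr; set t := 2 ^+ 20; lra.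
Qed.

End LowerBound.

Theorem theorem2 (R : realType) :
  exists C1 C2 c : R,
    [/\ 0 < C1, 0 < C2, 0 < c &
      forall (N : nat) (x : 'I_N -> R), (1 <= N)%N ->
        pair_deviation x <= C1 * N%:R ^+ 2 * discrepancy x ^+ 2 /\
        (C2 * N%:R `^ (- (1 / 3)) <= discrepancy x ->
         c * N%:R ^+ 2 * discrepancy x ^+ 5 <= pair_deviation x)].
Proof.
exists 4, 64, (2 ^+ 21)^-1; split=> //.
move=> N x N0; split; first exact: pair_deviation_upper.
exact: pair_deviation_lower_bound.
Qed.
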